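(* Let $S\in\mathcal{I}_1\cap\mathcal{I}_2$ be such that the shortest $s$–$t$ path in $G(S)$ has length $2(\ell+1)$, and let $\Pi_\ell$ be an augmenting set in $G(S)$ of width $w$. Then there exists an ordered collection $\mathcal{P}$ of $w$ consecutive shortest augmenting paths in $G(S)$.
   Context: $\mathcal{M}_1=(V,\mathcal{I}_1)$, $\mathcal{M}_2=(V,\mathcal{I}_2)$ are matroids. For $S\in\mathcal{I}_1\cap\mathcal{I}_2$, the exchange graph $G(S)$ is the directed graph on $V\cup\{s,t\}$ with arcs: $(s,a)$ for $a\notin S$ with $S+a\in\mathcal{I}_1$; $(a,t)$ for $a\notin S$ with $S+a\in\mathcal{I}_2$; $(a,b)$ for $a\in S$, $b\notin S$ with $S-a+b\in\mathcal{I}_1$; $(b,a)$ for $a\in S$, $b\notin S$ with $S-a+b\in\mathcal{I}_2$. $D_i$ is the set of elements at distance exactly $i$ from $s$ in $G(S)$. An augmenting set in $G(S)$ is a sequence $(B_1,A_1,\dots,A_\ell,B_{\ell+1})$ with: (a) $A_k\subseteq D_{2k}$, $B_k\subseteq D_{2k-1}$; (b) all sets have the same size $w$ (the width); (c) $S+B_1\in\mathcal{I}_1$; (d) $S+B_{\ell+1}\in\mathcal{I}_2$; (e) $S-A_k+B_{k+1}\in\mathcal{I}_1$ for $1\le k\le\ell$; (f) $S-A_k+B_k\in\mathcal{I}_2$ for $1\le k\le\ell$. Augmenting along a path $s,v_1,\dots,v_a,t$ replaces $S$ by $S+v_1-v_2+\cdots+v_a$. An ordered collection $(p_1,\dots,p_k)$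 is a collection of consecutive shortest augmenting paths in $G(S)$ if each $p_i$ has length $2(\ell+1)$ and is an $s$–$t$ path in $G(S_i)$, where $S_i$ is obtained from $S$ by augmenting along $p_1,\dots,p_{i-1}$ in order. *)

(* Defs.v *)
From HB Require Import structures.
From mathcomp Require Import all_boot.

Set Implicit Arguments.
Unset Strict Implicit.
Unset Printing Implicit Defensive.

Record matroid (V : finType) := Matroid {
  indep : {set {set V}};
  indep0 : set0 \in indep;
  indepS : forall A B : {set V}, A \subset B -> B \in indep -> A \in indep;
  indep_exchange : forall A B : {set V},
    A \in indep -> B \in indep -> #|A| < #|B| ->
    exists2 x, x \in B :\: A & x |: A \in indep }.

Definition common_indep (V : finType) (M1 M2 : matroid V) (S : {set V}) : bool :=
  (S \in indep M1) && (S \in indep M2).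

Variant xvertex (V : Type) := Src | Snk | Elt of V.
Arguments Src {V}.
Arguments Snk {V}.

Definition xvertex_code (V : Type) (x : xvertex V) : option (option V) :=
  match x with Src => None | Snk => Some None | Elt v => Some (Some v) end.
Definition xvertex_decode (V : Type) (x : option (option V)) : xvertex V :=
  match x with None => Src | Some None => Snk | Some (Some v) => Elt v end.
Lemma xvertex_codeK (V : Type) :
  cancel (@xvertex_code V) (@xvertex_decode V).
Proof. by case. Qed.
HB.instance Definition _ (V : finType) :=
  Finite.copy (xvertex V) (can_type (@xvertex_codeK V)).

(* The arc relation of the exchange graph G(S). *)
Definition exarc (V : finType) (M1 M2 : matroid V) (S : {set V}) :
    rel (xvertex V) :=
  fun x y => match x, y with
  | Src, Elt a => (a \notin S) && (a |: S \in indep M1)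
  | Elt a, Snk => (a \notin S) && (a |: S \in indep M2)
  | Elt u, Elt v =>
      [&& u \in S, v \notin S & v |: (S :\ u) \in indep M1]
      || [&& v \in S, u \notin S & u |: (S :\ v) \in indep M2]
  | _, _ => false
  end.

(* p lists the vertices after x; the length (number of arcs) is size p. *)
Definition dipath (T : eqType) (e : rel T) (x y : T) (p : seq T) : bool :=
  [&& path e x p, last x p == y & uniq (x :: p)].

Definition at_distance (T : eqType) (e : rel T) (x y : T) (n : nat) : Prop :=
  (exists2 p, dipath e x y p & size p = n) /\
  (forall p, dipath e x y p -> n <= size p).

(* v \in D_i *)
Definition in_layer (V : finType) (M1 M2 : matroid V) (S : {set V})
    (i : nat) (v : V) : Prop :=
  at_distance (exarc M1 M2 S) Src (Elt v) i.

(* The sequence (B_1, A_1, ..., A_l, B_(l+1)), 1-indexed: only the values A k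
   for 1 <= k <= l and B k for 1 <= k <= l+1 are relevant. *)
Record augmenting_set (V : finType) (M1 M2 : matroid V) (S : {set V})
    (l w : nat) (A B : nat -> {set V}) : Prop := AugmentingSet {
  augA_layer : forall k, 1 <= k <= l ->
    forall v, v \in A k -> in_layer M1 M2 S (2 * k) v;
  augB_layer : forall k, 1 <= k <= l.+1 ->
    forall v, v \in B k -> in_layer M1 M2 S (2 * k - 1) v;
  augA_width : forall k, 1 <= k <= l -> #|A k| = w;
  augB_width : forall k, 1 <= k <= l.+1 -> #|B k| = w;
  aug_first : S :|: B 1 \in indep M1;
  aug_last : S :|: B l.+1 \in indep M2;
  aug_indep1 : forall k, 1 <= k <= l ->
    (S :\: A k) :|: B k.+1 \in indep M1;
  aug_indep2 : forall k, 1 <= k <= l ->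
    (S :\: A k) :|: B k \in indep M2 }.

(* An s-t path s, v_1, ..., v_a, t is represented by its interior
   vs = [:: v_1; ...; v_a]; its length is (size vs).+1. *)
Definition st_path (V : finType) (M1 M2 : matroid V) (S : {set V})
    (vs : seq V) : bool :=
  dipath (exarc M1 M2 S) Src Snk (rcons [seq Elt v | v <- vs] Snk).

(* S + v_1 - v_2 + v_3 - ... *)
Fixpoint augment (V : finType) (S : {set V}) (vs : seq V) : {set V} :=
  match vs with
  | [::] => S
  | [:: v] => v |: S
  | v :: u :: vs' => augment ((v |: S) :\ u) vs'
  end.

(* 0-indexed: S after augmenting along the first i paths of P. *)
Definition augmented (V : finType) (S : {set V}) (P : seq (seq V)) (i : nat) :
    {set V} :=
  foldl (@augment V) S (take i P).

(* The common independence of each S_i is part of the definition because the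
   exchange graph G(S_i) is only meaningful for a common independent set. *)
Definition consecutive_shortest_paths (V : finType) (M1 M2 : matroid V)
    (S : {set V}) (l : nat) (P : seq (seq V)) : Prop :=
  forall i, i < size P ->
    let Si := augmented S P i in
    let p := nth [::] P i in
    [/\ common_indep M1 M2 Si, st_path M1 M2 Si p
      & (size p).+1 = 2 * l.+1].

(* Main.v *)
(* Inside one level of the exchange graph the exchanges only have to respect the
   local conditions (e) and (f), and exchanges made in distinct levels never
   interfere: an arc of [M1] or [M2] skipping a level would contradict the
   distances from [s], so whatever is added in one level lies in the span of the
   part of [S] surviving in the others.  It therefore suffices to pick a path
   b_1, a_1, ..., b_(l+1) greedily, each vertex from the previous one by the
   exchange property towards the full augmenting set; removing the path leaves
   an augmenting set of width one less with respect to the same levels of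
   [G(S)], and all paths have one pair per level, hence the right length. *)
Require Import Defs.
From HB Require Import structures.
From mathcomp Require Import all_boot zify.

Set Implicit Arguments.
Unset Strict Implicit.
Unset Printing Implicit Defensive.

(** * Matroid exchanges, and gluing exchanges made in separate layers *)

Section Matroid.
Variables (V : finType) (M : matroid V).
Implicit Types (C D I J S W X Y Z T : {set V}).

Lemma cardsU_disjoint C D : [disjoint C & D] -> #|C :|: D| = #|C| + #|D|.
Proof. by move=> disCD; rewrite cardsU disjoint_setI0 ?cards0 ?subn0. Qed.

Lemma indep_extend I J :
  I \in indep M -> J \in indep M -> #|I| <= #|J| ->
  exists E : {set V},
    [/\ I \subset E, E \subset I :|: J, E \in indep M & #|E| = #|J|].
Proof.
move=> + indJ; have [n] := ubnP (#|J| - #|I|); elim: n I => // n IHn I ltn indI.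
rewrite leq_eqVlt => /predU1P[eqIJ | ltIJ].
  by exists I; rewrite subxx subsetUl.
have [x /setDP[xJ xI] indxI] := indep_exchange indI indJ ltIJ.
have cardxI : #|x |: I| = #|I|.+1 by rewrite cardsU1 xI.
have [||E [sIE sEJ indE cardE]] := IHn _ _ indxI; [lia | lia |].
exists E; split=> //; first exact: subset_trans (subsetUr _ _) sIE.
apply: subset_trans sEJ _; rewrite -setUA subUset subxx sub1set !inE xJ.
by rewrite orbT.
Qed.

(** The circuit of [v |: S] avoids every [u] in [C], so it survives the removal of [C]. Without
    circuits: an independent [v |: (S :\: C)] would extend inside [v |: S] to size [#|S|], and the
    single element missed would be a [u] in [C] that can be exchanged for [v]. *)
Lemma swap_dependent S C v :
  S \in indep M -> v |: S \notin indep M ->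
  (forall u, u \in C -> v |: (S :\ u) \notin indep M) ->
  v |: (S :\: C) \notin indep M.
Proof.
move=> indS depvS depC; apply/negP => indvSC.
have vS : v \notin S.
  by apply: contra depvS => vS; rewrite (setUidPr _) ?sub1set.
have subvS : v |: (S :\: C) \subset v |: S by rewrite setUS ?subsetDl.
have prop_vS : v |: (S :\: C) \proper v |: S.
  by rewrite properEneq subvS andbT; apply: contra depvS => /eqP <-.
have lecard : #|v |: (S :\: C)| <= #|S|.
  by move: (proper_card prop_vS); rewrite [#|v |: S|]cardsU1 vS.
have [E [sE sES indE cardE]] := indep_extend indvSC indS lecard.
have [u uS uE] : exists2 u, u \in S & u \notin E.
  apply/subsetPn; apply/negP => sSE; move: depvS.
  rewrite (indepS _ indE) // subUset sSE andbT.
  by apply: subset_trans sE; apply: subsetUl.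
have uC : u \in C.
  by apply: contraR uE => uC; apply: (subsetP sE); rewrite !inE uS uC orbT.
have neq_vu : v != u by apply: contraNneq vS => ->.
have eqE : E = v |: (S :\ u).
  apply/eqP; rewrite eqEcard cardE cardsU1 !inE (negbTE vS) andbF (cardsD1 u S).
  rewrite uS leqnn andbT; apply/subsetP => x xE.
  have /setUP[] := subsetP sES _ xE; last first.
    by rewrite !inE => ->; rewrite andbT orbC (contraNneq _ uE) // => <-.
  rewrite !inE => /predU1P[-> | /andP[_ ->]]; first by rewrite eqxx.
  by rewrite andbT orbC (contraNneq _ uE) // => <-.
by have := depC _ uC; rewrite -eqE indE.
Qed.

(* [W] and [Y] span the same flat, so they extend by the same sets. *)
Lemma indep_replace W Y Z :
  W :|: Z \in indep M -> [disjoint W & Z] -> Y \in indep M -> #|Y| = #|W| ->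
  (forall y, y \in Y -> y \notin W -> y |: W \notin indep M) ->
  Y :|: Z \in indep M.
Proof.
move=> indWZ disWZ indY eqYW depW.
have cardWZ := cardsU_disjoint disWZ.
have [|E [sYE sE indE cardE]] := indep_extend indY indWZ; first lia.
have sEYZ : E \subset Y :|: Z.
  apply/subsetP => x xE; have := subsetP sE _ xE; rewrite !inE.
  have [//|xY] := boolP (x \in Y); have [xW _|//] := boolP (x \in W).
  have indxY : x |: Y \in indep M by rewrite (indepS _ indE) // subUset sub1set xE.
  have indW : W \in indep M by rewrite (indepS (subsetUl _ _) indWZ).
  (* If the extension of [Y] used some [x] of [W], then [x |: Y] would be larger than [W] and would
     augment it by an element of [Y], against [depW]. *)
  have [|y] := indep_exchange indW indxY; first by rewrite cardsU1 xY eqYW.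
  rewrite !inE => /andP[yW /predU1P[eq_yx | yY]]; first by rewrite eq_yx xW in yW.
  by rewrite (negbTE (depW _ yY yW)).
have /eqP <- // : E == Y :|: Z.
rewrite eqEcard sEYZ cardE cardWZ -eqYW cardsU; lia.
Qed.

Lemma exchange_out X T x :
  X \in indep M -> T \in indep M -> #|X| = #|T| -> x \in X :\: T ->
  exists2 y, y \in T :\: X & y |: (X :\ x) \in indep M.
Proof.
move=> indX indT eqXT /setDP[xX xT].
have indXx : X :\ x \in indep M by rewrite (indepS (subsetDl _ _) indX).
have [|y] := indep_exchange indXx indT.
  by rewrite -eqXT (cardsD1 x X) xX.
rewrite !inE => /andP[yX yT] indy; exists y => //; rewrite !inE yT andbT.
by apply: contra yX => ->; rewrite andbT; apply: contraNneq xT => <-.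
Qed.

(** Extend [y |: (X :&: T)] by elements of [X] up to size [#|X|]: exactly one element of [X] is left
    out, and it is not in [T] because [X :&: T] was kept. *)
Lemma exchange_in X T y :
  X \in indep M -> T \in indep M -> #|X| = #|T| -> y \in T :\: X ->
  exists2 x, x \in X :\: T & y |: (X :\ x) \in indep M.
Proof.
move=> indX indT eqXT /setDP[yT yX].
have sI : y |: (X :&: T) \subset T by rewrite subUset sub1set yT subsetIr.
have indI := indepS sI indT.
have [|E [sIE sE indE cardE]] := indep_extend indI indX.
  by rewrite eqXT subset_leq_card.
have yE : y \in E by rewrite (subsetP sIE) // !inE eqxx.
have [x xX xE] : exists2 x, x \in X & x \notin E.
  apply/subsetPn; apply/negP => sXE.
  have : y |: X \subset E by rewrite subUset sub1set yE.
  by move/subset_leq_card; rewrite cardsU1 yX cardE ltnn.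
exists x.
  rewrite !inE xX andbT; apply: contra xE => xT.
  by rewrite (subsetP sIE) // !inE xX xT orbT.
have /eqP <- // : E == y |: (X :\ x).
rewrite eqEcard cardE cardsU1 !inE (negbTE yX) andbF (cardsD1 x X) xX leqnn andbT.
apply/subsetP => z zE; have := subsetP sE _ zE; rewrite !inE => zX.
have [-> //|neq_zy] := eqVneq z y; apply/andP; split.
  by apply: contraNneq xE => <-.
by move: zX; rewrite (negbTE neq_zy) => /orP[/andP[]|].
Qed.

Lemma card_swap S C D :
  C \subset S -> [disjoint S & D] -> #|(S :\: C) :|: D| = #|S| - #|C| + #|D|.
Proof.
move=> sCS disSD; rewrite cardsU_disjoint ?(disjointWl (subsetDl _ _)) //.
by rewrite cardsD (setIidPr sCS).
Qed.

(* Layer by layer, everything added in an earlier layer lies in the span of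
   [S :\: C k], so exchanges in distinct layers do not interact. *)
Lemma indep_layers S n (C D : nat -> {set V}) :
  S \in indep M ->
  (forall k, k <= n -> C k \subset S) ->
  (forall k, k <= n -> [disjoint S & D k]) ->
  (forall k, k <= n -> (S :\: C k) :|: D k \in indep M) ->
  (forall j k, j < k <= n -> [disjoint C j & C k]) ->
  (forall j k, j < k <= n -> [disjoint D j & D k]) ->
  (forall k, k < n -> #|C k| = #|D k|) ->
  (forall k v, k < n -> v \in D k -> v |: S \notin indep M) ->
  (forall j k u v, j < k <= n -> v \in D j -> u \in C k ->
     v |: (S :\ u) \notin indep M) ->
  (S :\: \bigcup_(k < n.+1) C k) :|: \bigcup_(k < n.+1) D k \in indep M.
Proof.
move=> indS sCS disSD indCD disC disD cardCD depD depDC.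
(* Layers are merged one at a time. The equality of sizes stops at [m <= n]: the last layer may add
   more than it removes. *)
suff glue : forall m, m <= n.+1 ->
    (S :\: \bigcup_(k < m) C k) :|: \bigcup_(k < m) D k \in indep M /\
    (m <= n -> #|\bigcup_(k < m) C k| = #|\bigcup_(k < m) D k|).
  by have [] := glue n.+1 (leqnn _).
elim=> [|m IHm] ltmn.
  by rewrite !big_ord0 setD0 setU0 cards0.
have [indX eqUD] := IHm (ltnW ltmn); have {}eqUD := eqUD ltmn.
rewrite !big_ord_recr /=; set U := \bigcup_(k < m) C k in indX eqUD *.
set E := \bigcup_(k < m) D k in indX eqUD *.
have memE v : v \in E -> exists2 k, k < m & v \in D k.
  by case/bigcupP => k _ vk; exists k.
have memU v : v \in U -> exists2 k, k < m & v \in C k.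
  by case/bigcupP => k _ vk; exists k.
have disUC : [disjoint U & C m].
  rewrite -setI_eq0; apply/eqP/setP => x; rewrite !inE; apply/andP => -[].
  by move=> /memU[k ltkm xk]; apply/negP; rewrite (disjointFr (disC k m _)) ?ltkm.
have disED : [disjoint E & D m].
  rewrite -setI_eq0; apply/eqP/setP => x; rewrite !inE; apply/andP => -[].
  by move=> /memE[k ltkm xk]; apply/negP; rewrite (disjointFr (disD k m _)) ?ltkm.
have disSE : [disjoint S & E].
  rewrite -setI_eq0; apply/eqP/setP => x; rewrite !inE; apply/andP => -[].
  move=> xS /memE[k ltkm]; apply/negP; rewrite (disjointFr (disSD k _)) //; lia.
have sUS : U \subset S.
  by apply/subsetP => x /memU[k ltkm]; apply: subsetP; apply: sCS; lia.
split; last by move=> lemn; rewrite !cardsU_disjoint // eqUD cardCD.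
rewrite setUA [U :|: C m]setUC -setDDl.
(* The earlier layers turn [S :\: C m] into a set of the same size; by [swap_dependent] they add
   only elements of its span, so [D m] can still be added. *)
apply: (indep_replace (W := S :\: C m)).
- exact: indCD.
- by apply: disjointWl (disSD m _); rewrite ?subsetDl.
- apply: indepS indX; apply: setSU; apply: setSD; exact: subsetDl.
- rewrite card_swap; last 1 first.
  + by rewrite (disjointWl (subsetDl _ _)).
  + have sUW : U \subset S :\: C m by rewrite subsetD sUS.
    by rewrite -eqUD subnK ?subset_leq_card.
  by rewrite subsetD sUS.
- move=> y; rewrite !inE => /orP[/and3P[_ -> ->] //|/memE[k ltkm yk]] _.
  apply: swap_dependent => //; first by apply: (depD k) => //; lia.
  by move=> u uC; apply: (depDC k m) => //; lia.
Qed.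

End Matroid.

(** * Distances in a directed graph *)

Section Distance.
Variables (T : eqType) (e : rel T) (x : T).

(** Distances are defined by simple paths; shortening a walk makes the bound available when an
    appended arc repeats a vertex. *)
Lemma at_distance_le_path y p n :
  path e x p -> last x p = y -> at_distance e x y n -> n <= size p.
Proof.
move=> pathp + [_ min_n].
have [q pathq uniqq sqp lastq] := shortenP pathp.
apply: leq_trans (min_n q _) _.
  by rewrite /dipath pathq uniqq lastq eqxx.
by apply: uniq_leq_size => //; case/andP: uniqq.
Qed.

Lemma at_distance_arc y z n m :
  at_distance e x y n -> at_distance e x z m -> e y z -> m <= n.+1.
Proof.
move=> [[p /and3P[pathp /eqP lastp _] <-] _] distz eyz.
rewrite -(size_rcons p z); apply: at_distance_le_path distz; last exact: last_rcons.
by rewrite rcons_path pathp lastp.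
Qed.

Lemma at_distance_unique y n m :
  at_distance e x y n -> at_distance e x y m -> n = m.
Proof.
have le i j : at_distance e x y i -> at_distance e x y j -> i <= j.
  by move=> [_ mini] [[p dip <-] _]; apply: mini.
by move=> dn dm; apply/eqP; rewrite eqn_leq !le.
Qed.

End Distance.

(** * Layers of the exchange graph alternate between the two sides of [S] *)

Section ExchangeGraph.
Variables (V : finType) (M1 M2 : matroid V) (S : {set V}).

Lemma layer_parity i v : in_layer M1 M2 S i v -> (v \in S) = ~~ odd i.
Proof.
move=> [[p /and3P[pathp /eqP lastp _] <-] _].
(* The invariant must cover every possible end of a path prefix: no arc enters [Src], so only the
   empty path ends there, and no arc leaves [Snk], so nothing need be recorded there. *)
suff: match last Src p with
      | Src => nilp p | Snk => true | Elt v => (v \in S) == ~~ odd (size p)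
      end by rewrite lastp => /eqP.
elim/last_ind: p pathp {lastp} => // p y IHp.
rewrite rcons_path last_rcons size_rcons => /andP[/IHp].
case: (last Src p) => [||u]; case: y => [||w] //=.
  by move=> /nilP-> /andP[/negbTE->].
by move=> /eqP <- /orP[] /and3P[-> /negbTE->].
Qed.

End ExchangeGraph.

(** * Alternating paths with one pair of vertices per level *)

Section Zigzag.
Variables (V : finType) (a b : nat -> V).

Fixpoint zigzag k n : seq V :=
  if n is n'.+1 then [:: b k, a k.+1 & zigzag k.+1 n'] else [:: b k].

Lemma size_zigzag k n : size (zigzag k n) = n.*2.+1.
Proof. by elim: n k => //= n IHn k; rewrite IHn. Qed.

Lemma mem_zigzag k n x :
  reflect ((exists2 j, k < j <= k + n & x = a j) \/
           (exists2 j, k <= j <= k + n & x = b j)) (x \in zigzag k n).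
Proof.
elim: n k x => [|n IHn] k x /=.
  rewrite inE; apply: (iffP eqP) => [->|[[j]|[j]]].
  - by right; exists k; rewrite ?addn0 ?leqnn.
  - by lia.
  - by rewrite addn0 -eqn_leq => /eqP->.
rewrite !inE; apply: (iffP or3P) => [[/eqP->|/eqP->|/IHn]|].
- by right; exists k => //; lia.
- by left; exists k.+1 => //; lia.
- by case=> -[j ltj ->]; [left | right]; exists j => //; lia.
case=> -[j ltj ->].
  have [->|neq_j] := eqVneq j k.+1; first by constructor 2.
  by constructor 3; apply/IHn; left; exists j => //; lia.
have [->|neq_j] := eqVneq j k; first by constructor 1.
by constructor 3; apply/IHn; right; exists j => //; lia.
Qed.

Lemma uniq_zigzag k n :
  (forall i j, k < i < j -> j <= k + n -> a i != a j) ->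
  (forall i j, k <= i < j -> j <= k + n -> b i != b j) ->
  (forall i j, k < i <= k + n -> k <= j <= k + n -> a i != b j) ->
  uniq (zigzag k n).
Proof.
elim: n k => //= n IHn k inja injb neqab.
rewrite inE negb_or eq_sym neqab /=; [|lia|lia].
apply/and3P; split.
- apply/mem_zigzag => -[[j ltj eqbj]|[j ltj eqbj]].
  + by have := neqab j k; rewrite eqbj eqxx /=; lia.
  + by have := injb k j; rewrite eqbj eqxx /=; lia.
- apply/mem_zigzag => -[[j ltj eqaj]|[j ltj eqaj]].
  + by have := inja k.+1 j; rewrite eqaj eqxx /=; lia.
  + by have := neqab k.+1 j; rewrite eqaj eqxx /=; lia.
- by apply: IHn => i j *; [apply: inja | apply: injb | apply: neqab]; lia.
Qed.

(** As no [a i] equals a [b j], the order of additions and removals in [augment] is immaterial. *)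
Lemma mem_augment_zigzag (X : {set V}) k n x :
  (forall i j, k < i <= k + n -> k <= j <= k + n -> a i != b j) ->
  reflect ((exists2 j, k <= j <= k + n & x = b j) \/
           x \in X /\ forall j, k < j <= k + n -> x != a j)
          (x \in augment X (zigzag k n)).
Proof.
elim: n k X => [|n IHn] k X neqab.
  rewrite /= !inE; apply: (iffP predU1P) => [[->|xX]|].
  - by left; exists k => //; lia.
  - by right; split=> // j; lia.
  - by case=> [[j]|[]]; [rewrite addn0 -eqn_leq => /eqP-> ->; left | right].
have {}IHn := IHn k.+1.
have -> : augment X (zigzag k n.+1) =
          augment ((b k |: X) :\ a k.+1) (zigzag k.+1 n) by [].
have neqab' i j :
    k.+1 < i <= k.+1 + n -> k.+1 <= j <= k.+1 + n -> a i != b j.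
  by move=> *; apply: neqab; lia.
apply: (iffP (IHn _ neqab')).
case=> [[j ltj ->]|[]].
- by left; exists j => //; lia.
- rewrite !inE => /andP[neqx /predU1P[->|xX]] neqxa.
    by left; exists k => //; lia.
  right; split=> // j ltj; have [->//|neqj] := eqVneq j k.+1.
  by apply: neqxa; lia.
case=> [[j ltj ->]|[xX neqx]].
  have [->|neqj] := eqVneq j k; last by left; exists j => //; lia.
  right; split=> [|i ltI]; rewrite ?inE ?eqxx /= ?andbT eq_sym neqab //; lia.
by right; split=> [|j ltj]; rewrite ?inE ?xX ?orbT ?andbT; apply: neqx; lia.
Qed.

(** The start [x] is arbitrary because the induction resumes from [a k.+1] rather than from
    [Src]. *)
Lemma path_zigzag (M1 M2 : matroid V) (X : {set V}) k n x :
  exarc M1 M2 X x (Elt (b k)) ->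
  (forall j, k <= j < k + n -> exarc M1 M2 X (Elt (b j)) (Elt (a j.+1))) ->
  (forall j, k < j <= k + n -> exarc M1 M2 X (Elt (a j)) (Elt (b j))) ->
  exarc M1 M2 X (Elt (b (k + n))) Snk ->
  path (exarc M1 M2 X) x (rcons [seq Elt v | v <- zigzag k n] Snk).
Proof.
elim: n k x => [|n IHn] k x arcx arcba arcab arcT.
  by move: arcT; rewrite addn0 /= arcx => ->.
rewrite [zigzag _ _]/= !map_cons !rcons_cons.
have -> : forall y z (s : seq (xvertex V)),
    path (exarc M1 M2 X) x [:: y, z & s] =
    [&& exarc M1 M2 X x y, exarc M1 M2 X y z & path (exarc M1 M2 X) z s] by [].
rewrite arcx arcba ?IHn //=; last lia.
- by apply: arcab; lia.
- by move=> j ltj; apply: arcba; lia.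
- by move=> j ltj; apply: arcab; lia.
- by rewrite addSnnS.
Qed.

End Zigzag.

(** * Extracting the paths one by one from the levels *)

Section Layers.
Variables (V : finType) (M1 M2 : matroid V) (S : {set V}) (l w : nat).
(* Here [B] is indexed from 0, so that [A k] and [B k] share a level of [M1],
   and [A k.+1] and [B k] share a level of [M2]. *)
Variables A B : nat -> {set V}.
Implicit Types C D F G : nat -> {set V}.
Hypotheses (indS1 : S \in indep M1) (indS2 : S \in indep M2).
Hypothesis A_out : forall k, ~~ (0 < k <= l) -> A k = set0.
Hypothesis sAS : forall k, A k \subset S.
Hypothesis disSB : forall k, [disjoint S & B k].
Hypothesis disA : forall j k, j != k -> [disjoint A j & A k].
Hypothesis disB : forall j k, j != k -> [disjoint B j & B k].
Hypothesis cardA : forall k, 0 < k <= l -> #|A k| = w.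
Hypothesis cardB : forall k, k <= l -> #|B k| = w.
Hypothesis indAB1 : forall k, k <= l -> (S :\: A k) :|: B k \in indep M1.
Hypothesis indAB2 : forall k, k <= l -> (S :\: A k.+1) :|: B k \in indep M2.
(** The four dependence hypotheses exclude shortcut arcs: from the source past [B 0], from [A j]
    past [B j], from [B k] to the sink before level [l], and from [B j] past [A j.+1]. *)
Hypothesis depB1 : forall k v, 0 < k -> v \in B k -> v |: S \notin indep M1.
Hypothesis depAB1 : forall j k u v,
  j < k -> u \in A j -> v \in B k -> v |: (S :\ u) \notin indep M1.
Hypothesis depB2 : forall k v, k < l -> v \in B k -> v |: S \notin indep M2.
Hypothesis depAB2 : forall j k u v,
  j < k -> v \in B j -> u \in A k.+1 -> v |: (S :\ u) \notin indep M2.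

(** The range of [C] has both empty ends [0] and [l.+1]: dropping the last one pairs [C k] with
    [D k] for [M1], dropping the first pairs [C k.+1] with [D k] for [M2]. *)
Definition swap (C D : nat -> {set V}) : {set V} :=
  (S :\: \bigcup_(k < l.+2) C k) :|: \bigcup_(k < l.+1) D k.

Lemma swapP C D x :
  (forall k, C k \subset A k) ->
  reflect ((exists2 k, k <= l & x \in D k) \/
           (x \in S /\ forall k, x \notin C k))
          (x \in swap C D).
Proof.
move=> sCA; rewrite !inE orbC.
apply: (iffP orP) => [[|/andP[xC xS]]|[[k lek xk]|[xS xC]]].
- by case/bigcupP => k _ xk; left; exists k; rewrite // -ltnS.
- right; split=> // k; have [lek|ltk] := ltnP k l.+2.
    by apply: contra xC => xk; apply/bigcupP; exists (Ordinal lek).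
  by apply/negP => /(subsetP (sCA k)); rewrite A_out ?inE //; lia.
- by left; apply/bigcupP; exists (Ordinal (lek : k < l.+1)).
- by right; rewrite xS andbT; apply/bigcupP => -[k _]; apply/negP.
Qed.

Lemma swap_indep1 C D :
  (forall k, C k \subset A k) -> (forall k, D k \subset B k) ->
  (forall k, 0 < k <= l -> #|C k| = #|D k|) ->
  (forall k, k <= l -> (S :\: C k) :|: D k \in indep M1) ->
  swap C D \in indep M1.
Proof.
move=> sCA sDB cardCD indCD.
(* For [M1] the excluded arcs go from lower [A] to higher [B], so the layers are glued from the top
   down. Level [0], where [D 0] is added and nothing removed, then comes last, as [indep_layers]
   requires. *)
have -> : swap C D = (S :\: \bigcup_(k < l.+1) C (l - k)) :|:
                     \bigcup_(k < l.+1) D (l - k).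
  rewrite /swap big_ord_recr /=.
  have -> : C l.+1 = set0 by apply/eqP; rewrite -subset0 -(@A_out l.+1) ?ltnn.
  by rewrite setU0 (reindex_inj rev_ord_inj) [X in _ :|: X](reindex_inj rev_ord_inj).
apply: (@indep_layers _ _ _ _ (fun k => C (l - k)) (fun k => D (l - k))) => //.
- by move=> k _; apply: subset_trans (sCA _) (sAS _).
- by move=> k _; apply: disjointWr (sDB _) (disSB _).
- by move=> k lek; apply: indCD; lia.
- by move=> j k ltjk; apply: disjointW (sCA _) (sCA _) (disA _); lia.
- by move=> j k ltjk; apply: disjointW (sDB _) (sDB _) (disB _); lia.
- by move=> k ltk; apply: cardCD; lia.
- by move=> k v ltk /(subsetP (sDB _)); apply: depB1; lia.
- move=> j k u v ltjk /(subsetP (sDB _)) vB /(subsetP (sCA _)) uA.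
  by apply: depAB1 uA vB; lia.
Qed.

Lemma swap_indep2 C D :
  (forall k, C k \subset A k) -> (forall k, D k \subset B k) ->
  (forall k, k < l -> #|C k.+1| = #|D k|) ->
  (forall k, k <= l -> (S :\: C k.+1) :|: D k \in indep M2) ->
  swap C D \in indep M2.
Proof.
move=> sCA sDB cardCD indCD.
(* For [M2] the increasing order is the right one, and the unbalanced layer is the last, with
   [C l.+1] empty. *)
have C0 : C 0 = set0 by apply/eqP; rewrite -subset0 -(@A_out 0).
rewrite /swap big_ord_recl C0 set0U.
apply: (@indep_layers _ _ _ _ (fun k => C k.+1) D) => //.
- by move=> k _; apply: subset_trans (sCA _) (sAS _).
- by move=> k _; apply: disjointWr (sDB _) (disSB _).
- by move=> j k ltjk; apply: disjointW (sCA _) (sCA _) (disA _); lia.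
- by move=> j k ltjk; apply: disjointW (sDB _) (sDB _) (disB _); lia.
- by move=> k v ltk /(subsetP (sDB _)); apply: depB2.
- move=> j k u v ltjk /(subsetP (sDB _)) vB /(subsetP (sCA _)) uA.
  by apply: depAB2 vB uA; lia.
Qed.

(** Changing [C] or [D] at a single level turns an arc of the current exchange graph into the
    independence of another [swap]. *)
Definition insert_at F (k : nat) (x : V) : nat -> {set V} :=
  fun j => if j == k then x |: F j else F j.

Lemma insert_at_subset F G k x :
  (forall j, F j \subset G j) -> x \in G k ->
  forall j, insert_at F k x j \subset G j.
Proof.
move=> sFG xG j; rewrite /insert_at; case: eqP => // ->.
by rewrite subUset sub1set xG sFG.
Qed.

Lemma card_insert_at F k x : x \notin F k ->
  forall j, #|insert_at F k x j| = (j == k) + #|F j|.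
Proof.
by move=> xF j; rewrite /insert_at; case: eqP => // ->; rewrite cardsU1 xF.
Qed.

Lemma notin_B_of_S k x : x \in S -> x \notin B k.
Proof. by move=> xS; rewrite (disjointFr (disSB k)). Qed.

Lemma swap_insert_r C D k b :
  k <= l -> swap C (insert_at D k b) = b |: swap C D.
Proof.
move=> lek; have ltk : k < l.+1 by [].
rewrite /swap (bigD1 (Ordinal ltk)) //= [in RHS](bigD1 (Ordinal ltk)) //=.
rewrite {1}/insert_at eqxx -!setUA setUCA; do 3![congr (_ :|: _)].
by apply: eq_bigr => j; rewrite /insert_at -val_eqE /= => /negbTE->.
Qed.

Lemma swap_insert_l C D k a :
  k <= l -> (forall j, D j \subset B j) -> a \in S ->
  swap (insert_at C k a) D = swap C D :\ a.
Proof.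
move=> lek sDB aS; have ltk : k < l.+2 by lia.
rewrite /swap (bigD1 (Ordinal ltk)) //= [in RHS](bigD1 (Ordinal ltk)) //=.
rewrite {1}/insert_at eqxx setDUl; congr (_ :|: _).
  rewrite [RHS]setDDl [X in _ = _ :\: X]setUC setUA; congr (_ :\: (_ :|: _)).
  by apply: eq_bigr => j; rewrite /insert_at -val_eqE /= => /negbTE->.
apply/esym/setDidPl; rewrite disjoint_sym disjoints1; apply/bigcupP => -[j _].
by move=> /(subsetP (sDB _)); apply/negP/notin_B_of_S.
Qed.

(* [C k] and [D k] collect the vertices of [i] augmenting paths already used; the
   current independent set is then [swap C D]. *)
Record balanced (i : nat) (C D : nat -> {set V}) : Prop := Balanced {
  bal_sCA : forall k, C k \subset A k;
  bal_sDB : forall k, D k \subset B k;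
  bal_cardC : forall k, 0 < k <= l -> #|C k| = i;
  bal_cardD : forall k, k <= l -> #|D k| = i;
  bal_indep1 : forall k, k <= l -> (S :\: C k) :|: D k \in indep M1;
  bal_indep2 : forall k, k <= l -> (S :\: C k.+1) :|: D k \in indep M2 }.

Section Balanced.
Variables (i : nat) (C D : nat -> {set V}).
Hypothesis balCD : balanced i C D.

Let sCA := bal_sCA balCD.
Let sDB := bal_sDB balCD.

Lemma balanced_common : common_indep M1 M2 (swap C D).
Proof.
case: balCD => _ _ cardC cardD indCD1 indCD2; apply/andP; split.
  by apply: swap_indep1 => // k lek; rewrite cardC ?cardD //; lia.
by apply: swap_indep2 => // k lek; rewrite cardC ?cardD //; lia.
Qed.

Lemma local_swap j k a b :
  a \in A j -> b |: (((S :\: C j) :|: D k) :\ a) =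
               (S :\: (a |: C j)) :|: (b |: D k).
Proof.
move=> /(subsetP (sAS j)) aS; apply/setP => x; rewrite !inE.
have [->|neqx] /= := eqVneq x a; last by rewrite orbCA.
by rewrite (negbTE (contra (subsetP (sDB k) a) (notin_B_of_S k aS))) orbF.
Qed.

Lemma card_local j k : 0 < j <= l -> k <= l ->
  #|(S :\: C j) :|: D k| = #|S| /\ #|(S :\: A j) :|: B k| = #|S|.
Proof.
case: balCD => _ _ cardC cardD _ _ ltj lek.
have le_w : w <= #|S| by rewrite -(cardA ltj) subset_leq_card.
have le_iw : i <= w by rewrite -(cardA ltj) -(cardC _ ltj) subset_leq_card.
rewrite !card_swap ?(subset_trans (sCA j)) //; last exact: disjointWr (sDB k) _.
by rewrite cardC // cardD // cardA // cardB //; split; lia.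
Qed.

Lemma setD_local_removed j k x :
  x \in ((S :\: C j) :|: D k) :\: ((S :\: A j) :|: B k) -> x \in A j :\: C j.
Proof.
rewrite !inE negb_or negb_and negbK => /andP[/andP[xA xB] xX].
move: xX; rewrite (negbTE (contra (subsetP (sDB k) x) xB)) orbF => /andP[-> xS].
by rewrite xS orbF in xA.
Qed.

Lemma setD_local_added j k x :
  x \in ((S :\: A j) :|: B k) :\: ((S :\: C j) :|: D k) -> x \in B k :\: D k.
Proof.
rewrite !inE negb_or negb_and negbK => /andP[/andP[xC xD]].
rewrite xD => /orP[/andP[xA xS]|//]; case/orP: xC => [/(subsetP (sCA j))|].
  by rewrite (negbTE xA).
by rewrite xS.
Qed.

Lemma next_b k a : 0 < k <= l -> a \in A k :\: C k ->
  exists2 b, b \in B k :\: D k &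
             (S :\: (a |: C k)) :|: (b |: D k) \in indep M1.
Proof.
move=> ltk /setDP[aA aC]; have lek : k <= l by case/andP: ltk.
have [eqX eqT] := card_local ltk lek; have aS := subsetP (sAS k) a aA.
have [||||b bB indb] :=
  @exchange_out _ M1 ((S :\: C k) :|: D k) ((S :\: A k) :|: B k) a.
- exact: bal_indep1 balCD _ lek.
- exact: indAB1.
- by rewrite eqX eqT.
- by rewrite !inE aA aS aC /= (negbTE (notin_B_of_S k aS)).
by exists b; [exact: setD_local_added bB | rewrite -local_swap].
Qed.

(** The dual exchange in [M2]: here the vertex entering is prescribed and the one leaving is
    found. *)
Lemma next_a k b : k < l -> b \in B k :\: D k ->
  exists2 a, a \in A k.+1 :\: C k.+1 &
             (S :\: (a |: C k.+1)) :|: (b |: D k) \in indep M2.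
Proof.
move=> ltk /setDP[bB bD]; have lek := ltnW ltk.
have [eqX eqT] := card_local (ltk : 0 < k.+1 <= l) lek.
have bS : b \notin S by rewrite (disjointFl (disSB k)).
have [||||a aA inda] :=
  @exchange_in _ M2 ((S :\: C k.+1) :|: D k) ((S :\: A k.+1) :|: B k) b.
- exact: bal_indep2 balCD _ lek.
- exact: indAB2.
- by rewrite eqX eqT.
- by rewrite !inE bB (negbTE bD) (negbTE bS) andbF orbT.
have {}aA := setD_local_removed aA; exists a => //.
by rewrite -local_swap //; case/setDP: aA.
Qed.

Hypothesis lt_iw : i < w.

Lemma augmenting_chain : exists a b : nat -> V,
  [/\ forall k, k <= l -> b k \in B k :\: D k,
      forall k, 0 < k <= l -> a k \in A k :\: C k,
      forall k, 0 < k <= l ->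
        (S :\: (a k |: C k)) :|: (b k |: D k) \in indep M1
    & forall k, k < l ->
        (S :\: (a k.+1 |: C k.+1)) :|: (b k |: D k) \in indep M2].
Proof.
suff chain n : n <= l -> exists a b : nat -> V,
  [/\ forall k, k <= n -> b k \in B k :\: D k,
      forall k, 0 < k <= n -> a k \in A k :\: C k,
      forall k, 0 < k <= n ->
        (S :\: (a k |: C k)) :|: (b k |: D k) \in indep M1
    & forall k, k < n ->
        (S :\: (a k.+1 |: C k.+1)) :|: (b k |: D k) \in indep M2].
  exact: chain.
elim: n => [_|n IHn ltn].
  have /set0Pn[b0 bB] : B 0 :\: D 0 != set0.
    rewrite -card_gt0 cardsD (setIidPr (sDB 0)).
    by rewrite (bal_cardD balCD) // cardB // subn_gt0.
  (* For [n = 0] no [a k] is constrained, so [b0] serves as a placeholder. *)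
  exists (fun=> b0), (fun=> b0); split=> // k; try lia.
  by rewrite leqn0 => /eqP->.
have [a [b [bB aA ind1 ind2]]] := IHn (ltnW ltn).
have [a' aA' ind2'] := next_a ltn (bB n (leqnn n)).
have [//|b' bB' ind1'] := next_b _ aA'.
exists (fun k => if k == n.+1 then a' else a k).
exists (fun k => if k == n.+1 then b' else b k).
split=> k ltk.
- by case: eqP => [->//|neqk]; apply: bB; lia.
- by case: eqP => [->//|neqk]; apply: aA; lia.
- by case: eqP => [->//|neqk]; apply: ind1; lia.
- rewrite eqSS (ltn_eqF (ltk : k < n.+1)).
  by case: eqP => [->//|neqk]; apply: ind2; lia.
Qed.

(** The chain [b 0, a 1, b 1, ..., b l] is the path. Each arc alters the used sets at one level
    only, where the chain supplies independence; the other levels keep theirs from [balCD]. *)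
Lemma balanced_step : exists p C' D',
  [/\ st_path M1 M2 (swap C D) p, (size p).+1 = 2 * l.+1,
      augment (swap C D) p = swap C' D' & balanced i.+1 C' D'].
Proof.
have [a [b [bB aA ind1 ind2]]] := augmenting_chain.
have [_ _ cardC cardD indCD1 indCD2] := balCD.
have bBk k : k <= l -> b k \in B k by move/bB => /setDP[].
have bDk k : k <= l -> b k \notin D k by move/bB => /setDP[].
have aAk k : 0 < k <= l -> a k \in A k by move/aA => /setDP[].
have aCk k : 0 < k <= l -> a k \notin C k by move/aA => /setDP[].
have aS k : 0 < k <= l -> a k \in S by move/aAk; apply: subsetP.
have bS k : k <= l -> b k \notin S.
  by move/bBk => bk; rewrite (disjointFl (disSB k)).
have inA x j k : x \in A j -> x \in A k -> j = k.
  by move=> xj xk; apply: contraTeq xk => /disA/disjointFr->.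
have inB x j k : x \in B j -> x \in B k -> j = k.
  by move=> xj xk; apply: contraTeq xk => /disB/disjointFr->.
have aX k : 0 < k <= l -> a k \in swap C D.
  move=> ltk; apply/swapP => //; right; split=> [|j]; first exact: aS.
  apply: contra (aCk k ltk) => aC.
  by move: (aC); rewrite (inA _ _ _ (subsetP (sCA j) _ aC) (aAk k ltk)).
have bX k : k <= l -> b k \notin swap C D.
  move=> lek; apply/swapP => // -[[j lej bD]|[]]; last first.
    by rewrite (negbTE (bS k lek)).
  move: (bD); rewrite (inB _ _ _ (subsetP (sDB j) _ bD) (bBk k lek)).
  by rewrite (negbTE (bDk k lek)).
have neqab j k : 0 < j <= l -> k <= l -> a j != b k.
  by move=> ltj lek; apply: contraNneq (bS k lek) => <-; apply: aS.
(* At the two ends nothing is removed, and any part of [B 0] or [B l] can be added to [S]. *)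
have first1 : (S :\: C 0) :|: (b 0 |: D 0) \in indep M1.
  apply: indepS (indAB1 (leq0n l)); rewrite A_out // setD0 setUSS ?subsetDl //.
  by rewrite subUset sub1set bBk ?sDB.
have last2 : (S :\: C l.+1) :|: (b l |: D l) \in indep M2.
  apply: indepS (indAB2 (leqnn l)); rewrite A_out ?ltnn // setD0 setUSS ?subsetDl //.
  by rewrite subUset sub1set bBk ?sDB.
exists (zigzag a b 0 l).
exists (fun k => if 0 < k <= l then a k |: C k else C k).
exists (fun k => if k <= l then b k |: D k else D k).
split.
- apply/and3P; split; last 1 first.
  + rewrite /= mem_rcons inE /= rcons_uniq map_inj_uniq => [|x y []//].
    have notmem x : (forall v, x != Elt v) ->
        x \notin [seq Elt v | v <- zigzag a b 0 l].
      by move=> neqx; apply/mapP => -[v _ eqx]; case/eqP: (neqx v).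
    rewrite !notmem //; apply: uniq_zigzag.
    * move=> j k ltj lek; apply/eqP => eqa.
      have := aAk j; rewrite eqa => /(_ _) aj.
      by have := inA _ _ _ (aj _) (aAk k _); lia.
    * move=> j k ltj lek; apply/eqP => eqb.
      have := bBk j; rewrite eqb => /(_ _) bj.
      by have := inB _ _ _ (bj _) (bBk k _); lia.
    * by move=> j k *; apply: neqab; lia.
  + apply: path_zigzag => /=.
    (* Only [D 0] grows, at the one level where [swap_indep1] does not ask for equal sizes. *)
    * rewrite bX // -(@swap_insert_r C D 0) //=; apply: swap_indep1 => //.
      - exact: insert_at_subset (bBk 0 _).
      - by move=> k ltk; rewrite card_insert_at ?bDk // cardC ?cardD //; lia.
      - move=> k lek; rewrite /insert_at; case: eqP => [->//|_].
        exact: indCD1.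
    * move=> k ltk; apply/orP; right; rewrite aX ?bX /=; try lia.
      rewrite -(@swap_insert_l C D k.+1) ?aS -?(@swap_insert_r _ D k) //; try lia.
      apply: swap_indep2.
      - by apply: insert_at_subset => //; apply: aAk; lia.
      - by apply: insert_at_subset => //; apply: bBk; lia.
      - move=> j ltj; rewrite !card_insert_at ?aCk ?bDk //; try lia.
        by rewrite eqSS cardC ?cardD //; lia.
      - move=> j lej; rewrite /insert_at eqSS.
        by case: eqP => [->|_]; [apply: ind2; lia | apply: indCD2].
    * move=> k ltk; apply/orP; left; rewrite aX ?bX /=; try lia.
      rewrite -(@swap_insert_l C D k) ?aS -?(@swap_insert_r _ D k) //; try lia.
      apply: swap_indep1.
      - by apply: insert_at_subset => //; apply: aAk; lia.
      - by apply: insert_at_subset => //; apply: bBk; lia.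
      - move=> j ltj; rewrite !card_insert_at ?aCk ?bDk //; try lia.
        by rewrite cardC ?cardD //; lia.
      - move=> j lej; rewrite /insert_at.
        by case: eqP => [->|_]; [apply: ind1; lia | apply: indCD1].
    * rewrite add0n bX // -(@swap_insert_r C D l) //=; apply: swap_indep2 => //.
      - exact: insert_at_subset (bBk l _).
      - move=> k ltk; rewrite card_insert_at ?bDk // (ltn_eqF ltk).
        by rewrite cardC ?cardD //; lia.
      - move=> k lek; rewrite /insert_at; case: eqP => [->//|_].
        exact: indCD2.
  + by rewrite last_rcons.
- by rewrite size_zigzag; lia.
- apply/setP => x; apply/mem_augment_zigzag/swapP.
  + by move=> j k *; apply: neqab; lia.
  + by move=> k; case: ifP => // ltk; rewrite subUset sub1set aAk ?sCA.
  + case=> [[j ltj ->]|[/(swapP _ _ sCA)[[k lek xk]|[xS xC]] xa]].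
    * by left; exists j; rewrite // [j <= l]ltj !inE eqxx.
    * by left; exists k; rewrite // lek !inE xk orbT.
    * right; split=> // k; case: ifP => // ltk; rewrite !inE negb_or xC andbT.
      by apply: xa; lia.
  + case=> [[k lek]|[xS xC]].
      rewrite lek in_setU1 => /predU1P[->|xk]; first by left; exists k.
      right; split=> [|j ltj]; first by apply/(swapP _ _ sCA); left; exists k.
      apply: contraTneq xk => ->; apply: (contra (subsetP (sDB k) _)).
      by apply: notin_B_of_S; apply: aS; lia.
    right; split=> [|j ltj].
      apply/(swapP _ _ sCA); right; split=> // k; have := xC k.
      by case: ifP => // _; rewrite !inE negb_or => /andP[].
    have := xC j; case: ifP; last lia.
    by rewrite !inE negb_or => _ /andP[].
- split=> k.
  + by case: ifP => // ltk; rewrite subUset sub1set aAk ?sCA.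
  + by case: ifP => // ltk; rewrite subUset sub1set bBk ?sDB.
  + by move=> ltk; rewrite ltk cardsU1 aCk // cardC.
  + by move=> lek; rewrite lek cardsU1 bDk // cardD.
  + move=> lek; rewrite lek andbT; case: posnP => [->//|k0]; apply: ind1; lia.
  + move=> lek; rewrite lek /=; case: ltnP => [ltk|gek]; first exact: ind2.
    by have -> : k = l by lia.
Qed.

End Balanced.

(** Induction on the number [n] of paths still to be found; the levels remain those of the original
    [S]. *)
Lemma balanced_paths n i C D : i + n = w -> balanced i C D ->
  exists P, size P = n /\ consecutive_shortest_paths M1 M2 (swap C D) l P.
Proof.
elim: n i C D => [|n IHn] i C D eqw balCD; first by exists [::].
have [|p [C' [D' [pathp sizep augp balCD']]]] := balanced_step balCD; first lia.
have [|P [sizeP consP]] := IHn _ _ _ _ balCD'; first lia.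
exists (p :: P); split=> [|[|k] ltk]; first by rewrite /= sizeP.
  by split=> //=; rewrite /augmented /= (balanced_common balCD).
by rewrite /augmented /= augp; apply: consP.
Qed.

Lemma layered_paths : exists P : seq (seq V),
  size P = w /\ consecutive_shortest_paths M1 M2 S l P.
Proof.
have swap0 : swap (fun=> set0) (fun=> set0) = S.
  by rewrite /swap !big1 // setD0 setU0.
rewrite -swap0; apply: (@balanced_paths w 0) => //; split=> k *.
all: by rewrite ?sub0set ?cards0 ?setD0 ?setU0.
Qed.

End Layers.

(** * From distances in the exchange graph to the level conditions *)

Theorem theorem6p14 (V : finType) (M1 M2 : matroid V) (S : {set V})
    (l w : nat) (A B : nat -> {set V})
    (S_common : common_indep M1 M2 S)
    (S_dist : at_distance (exarc M1 M2 S) Src Snk (2 * l.+1))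
    (AB_aug : augmenting_set M1 M2 S l w A B) :
  exists P : seq (seq V),
    size P = w /\ consecutive_shortest_paths M1 M2 S l P.
Proof.
have /andP[indS1 indS2] := S_common.
case: AB_aug => layA layB cardA cardB first1 last2 ind1 ind2.
(* With empty [A'] at [0] and [l.+1], and [B] shifted down by one, the conditions on the first and
   last [B] become the end cases of the exchange conditions. *)
pose A' k := if 0 < k <= l then A k else set0.
pose B' k := if k <= l then B k.+1 else set0.
have A'P k u : u \in A' k -> 0 < k <= l /\ in_layer M1 M2 S (2 * k) u.
  by rewrite /A'; case: ifP => [ltk /(layA _ ltk)|]; rewrite ?inE.
have B'P k v : v \in B' k -> k <= l /\ in_layer M1 M2 S (2 * k).+1 v.
  rewrite /B'; case: ifP => [lek vB|]; rewrite ?inE //.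
  by have -> : (2 * k).+1 = 2 * k.+1 - 1 by [lia]; split; last exact: layB vB.
have A'S k u : u \in A' k -> u \in S.
  by move=> /A'P[_ /layer_parity->]; rewrite mul2n odd_double.
have B'S k v : v \in B' k -> v \notin S.
  by move=> /B'P[_ /layer_parity->]; rewrite /= mul2n odd_double.
apply: (@layered_paths V M1 M2 S l w A' B') => //.
- by move=> k /negbTE; rewrite /A' => ->.
- by move=> k; apply/subsetP => u /A'S.
- by move=> k; rewrite disjoint_sym disjoint_subset; apply/subsetP => v /B'S.
- move=> j k neqjk; rewrite disjoint_subset; apply/subsetP => u /A'P[_ dj].
  rewrite inE; apply: contra neqjk => /A'P[_ dk].
  by have := at_distance_unique dj dk; lia.
- move=> j k neqjk; rewrite disjoint_subset; apply/subsetP => u /B'P[_ dj].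
  rewrite inE; apply: contra neqjk => /B'P[_ dk].
  by have := at_distance_unique dj dk; lia.
- by move=> k ltk; rewrite /A' ltk cardA.
- by move=> k lek; rewrite /B' lek cardB.
- move=> k lek; rewrite /A' /B' lek andbT; case: posnP => [->|k0].
    by rewrite setD0.
  by apply: ind1; rewrite k0.
- move=> k lek; rewrite /A' /B' lek /=; case: ltnP => [ltk|gek].
    exact: ind2.
  by have -> : k = l by [lia]; rewrite setD0.
(* In this and the next three goals independence would give an arc of [G(S)] that raises the
   distance from the source by more than one. *)
- move=> k v k0 vB; have [_ dv] := B'P _ _ vB; apply/negP => indv.
  have dist0 : at_distance (exarc M1 M2 S) Src Src 0 by split; first exists [::].
  have := at_distance_arc dist0 dv; rewrite /= (B'S _ _ vB) indv => /(_ isT).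
  by lia.
- move=> j k u v ltjk uA vB; have [[_ du] [_ dv]] := (A'P _ _ uA, B'P _ _ vB).
  apply/negP => indv; have := at_distance_arc du dv.
  by rewrite /= (A'S _ _ uA) (B'S _ _ vB) indv => /(_ isT); lia.
- move=> k v ltk vB; have [_ dv] := B'P _ _ vB; apply/negP => indv.
  have := at_distance_arc dv S_dist; rewrite /= (B'S _ _ vB) indv => /(_ isT).
  by lia.
- move=> j k u v ltjk vB uA; have [[_ du] [_ dv]] := (A'P _ _ uA, B'P _ _ vB).
  apply/negP => indv; have := at_distance_arc dv du.
  by rewrite /= (A'S _ _ uA) (B'S _ _ vB) indv orbT => /(_ isT); lia.
Qed.
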